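(* Let $K$ be a field equipped with a nonarchimedean valuation $\nu: K \to \mathbb{R}\cup\{\infty\}$ and an automorphic involution $a \mapsto \overline{a}$ (possibly the identity) with $\nu(\overline{a}) = \nu(a)$ for all $a\in K$. Let $A \in K^{r\times r}$ be Hermitian ($\overline{A}=A^T$) or skew-Hermitian ($\overline{A}=-A^T$), and let $v_1,\dots,v_n \in K^r$. Write \[ f = \det\Big(\sum_{i=1}^n x_i v_i \overline{v_i}^T + A\Big) = \sum_{S\subseteq[n]} c_S x^{[n]\setminus S}, \] with $c_S \in K$, where $x^T = \prod_{i\in T} x_i$. Then the function $p:\{0,1\}^n \to \mathbb{R}\cup\{\infty\}$ given by $p_S = \nu(c_S)$ is a valuated $\Delta$-matroid.
   Context: $\overline{v}$ and $\overline{A}$ denote entrywise application of the involution. $p_S := p(e_S)$ where $e_S=\sum_{i\in S}e_i$. For $p: \{0,1\}^n \to \mathbb{R}\cup\{\infty\}$, let $\operatorname{dom} p = \{x : p(x)\neq\infty\}$, $P_p = \operatorname{conv}\{(x,p(x)): x\in\operatorname{dom} p\}\subset\mathbb{R}^{n+1}$, and let $\mathcal{S}_p$ (the induced subdivision) be the collection of projections (deleting the last coordinate) of the lower faces of $P_p$ (faces supported by hyperplanes whose inner normal has positive last coordinate). The length of a segment with endpoints in $\{0,1\}^n$ is the Hamming distance of its endpoints. $p$ is a valuated $\Delta$-matroid if every edge of $\mathcal{S}_p$ has length at most $2$ (equivalently every cell of $\mathcal{S}_p$ is a $\Delta$-matroid polytope, i.e. a $0/1$-polytope all of whose edges have length at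 most 2). *)

(* Defs.v *)
From HB Require Import structures.
From mathcomp Require Import all_boot all_order all_algebra.
From mathcomp Require Import classical_sets reals constructive_ereal.
From mathcomp Require Import -(notations) mpoly.

Set Implicit Arguments.
Unset Strict Implicit.
Unset Printing Implicit Defensive.

Import Order.TTheory GRing.Theory Num.Theory.

Local Open Scope classical_set_scope.
Local Open Scope ring_scope.

                                                        
Record nonarchimedean_valuation (K : fieldType) (R : realType)
    (nu : K -> \bar R) : Prop := NonarchimedeanValuation {
  valuation_neqNy : forall x, nu x != -oo%E ;
  valuation_eqy : forall x, nu x = +oo%E <-> x = 0 ;
  valuationM : forall x y, nu (x * y) = (nu x + nu y)%E ;
  valuationD : forall x y, (Order.min (nu x) (nu y) <= nu (x + y)%R)%E
}.

Section ConvexGeometry.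
Variable R : realType.

Definition convex_hull (V : lmodType R) (X : set V) : set V :=
  [set x | exists (k : nat) (t : 'I_k -> R) (a : 'I_k -> V),
    [/\ forall i, 0 <= t i, \sum_i t i = 1, forall i, X (a i)
      & x = \sum_i t i *: a i]].

Definition segment (V : lmodType R) (a b : V) : set V :=
  convex_hull [set a; b].

Definition dotp (m : nat) (w z : 'rV[R]_m) : R := \sum_i w 0 i * z 0 i.

                                                             
Definition lower_face (n : nat) (P F : set 'rV[R]_(n + 1)) : Prop :=
  exists (w : 'rV[R]_(n + 1)) (b : R),
    [/\ 0 < rsubmx w 0 0, forall z, P z -> b <= dotp w z,
        F = P `&` [set z | dotp w z = b] & F !=set0].

Definition hamming (n : nat) (a b : 'rV[R]_n) : nat :=
  #|[pred i | a 0 i != b 0 i]|.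

End ConvexGeometry.

Section ValuatedDeltaMatroid.
Variables (R : realType) (n : nat).

Definition indicator (S : {set 'I_n}) : 'rV[R]_n := \row_i (i \in S)%:R.

                                                                            
Variable p : {set 'I_n} -> \bar R.

Definition dom : set {set 'I_n} := [set S | p S != +oo%E].

Definition lifted_polytope : set 'rV[R]_(n + 1) :=
  convex_hull [set row_mx (indicator S) (fine (p S))%:M | S in dom].

Definition induced_subdivision : set (set 'rV[R]_n) :=
  [set (fun z : 'rV[R]_(n + 1) => lsubmx z) @` F
     | F in lower_face lifted_polytope].

                                                                         
                                                                              
                                      
Definition valuated_delta_matroid : Prop :=
  (forall S, p S != -oo%E) /\
  (forall a b : 'rV[R]_n, a != b ->
     induced_subdivision (segment a b) -> (hamming a b <= 2)%N).

End ValuatedDeltaMatroid.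

Section DeterminantalPolynomial.
Variables (K : fieldType) (n : nat).

Definition det_poly (bar : K -> K) (r : nat) (A : 'M[K]_r)
    (v : 'I_n -> 'cV[K]_r) : mpoly n K :=
  \det (\sum_i mpolyX K (mnm1 i)
            *: map_mx (@mpolyC n K) (v i *m (map_mx bar (v i))^T)
        + map_mx (@mpolyC n K) A).

Definition squarefree_monomial (T : {set 'I_n}) : mpoly n K :=
  \prod_(i in T) mpolyX K (mnm1 i).

                                            
Definition compl_coef (f : mpoly n K) (S : {set 'I_n}) : K :=
  mcoeff (Multinom [tuple (i \notin S : nat) | i < n]) f.

End DeterminantalPolynomial.

(* Main.v *)
Require Import Defs.
From HB Require Import structures.
From mathcomp Require Import all_boot all_order all_algebra.
From mathcomp Require Import ring lra zify.
From mathcomp Require Import classical_sets reals constructive_ereal.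
From mathcomp Require Import -(notations) mpoly.

(** An edge of the subdivision with endpoints [e_S] and [e_T] gives weights for
    which [c_S] and [c_T] are the only coefficients of [f] of least weighted
    valuation.  For [i <> j] in the symmetric difference of [S] and [T], let
    [f_i], [f_j] and [f_0] be [f] at [x_j = 0], at [x_i = 0] and at
    [x_i = x_j = 0].  Then [f_i f_j - f_0 f] has a unique least term, the
    product of the monomials of [S] and [T].  Dodgson condensation writes this
    difference as [x_i x_j g h], and the involution carries [g] to [h] up to
    signs, so [g] and [h] have coefficientwise equal valuations.  Hence the
    least term of [g h] is the square of a monomial, and [S] and [T] differ only
    at [i] and [j]. *)

Set Implicit Arguments.
Unset Strict Implicit.
Unset Printing Implicit Defensive.

Import Order.TTheory GRing.Theory Num.Theory.

Local Open Scope ring_scope.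

(** * Determinants of low-rank updates *)

(** The block matrix with rows [M, - U] and [W, 1] becomes block triangular after a unitriangular
    factor on the right, and also after one on the left; this computes its determinant in two
    ways. *)
Lemma det_addmx_mul (F : fieldType) r k (M : 'M[F]_r) (U : 'M[F]_(r, k))
    (W : 'M[F]_(k, r)) :
  \det M != 0 ->
  \det (M + U *m W) = \det M * \det (1%:M + W *m invmx M *m U).
Proof.
move=> nzM; have uM : M \in unitmx by rewrite unitmxE unitfE.
have E1 : block_mx M (- U) W 1%:M *m block_mx 1%:M 0 (- W) 1%:M
          = block_mx (M + U *m W) (- U) 0 1%:M.
  rewrite mulmx_block !mulmx1 !mulmx0 mul1mx mulNmx mulmxN opprK !add0r.
  by rewrite subrr.
have E2 : block_mx 1%:M 0 (- (W *m invmx M)) 1%:M *m block_mx M (- U) W 1%:M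
          = block_mx M (- U) 0 (1%:M + W *m invmx M *m U).
  rewrite mulmx_block !mul1mx !mul0mx !mulNmx mulmxN opprK !addr0.
  by rewrite mulmxKV // addNr addrC.
move/(congr1 determinant): E1; rewrite det_mulmx det_lblock det_ublock.
rewrite !det1 !mulr1 => <-.
move/(congr1 determinant): E2; rewrite det_mulmx det_lblock det_ublock.
by rewrite !det1 !mul1r.
Qed.

Lemma det_block_mx11 (R : comNzRingType) (a b c d : 'M[R]_1) :
  \det (block_mx a b c d) = a 0 0 * d 0 0 - b 0 0 * c 0 0.
Proof.
pose i0 : 'I_(1 + 1) := lshift 1 ord0; pose i1 : 'I_(1 + 1) := rshift 1 ord0.
have j0 : lift i0 ord0 = i1 by apply/val_inj.
have j1 : lift i1 ord0 = i0 by apply/val_inj.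
rewrite (expand_det_row _ i0) big_split_ord !big_ord1 -/i0 -/i1.
rewrite /cofactor !det_mx11 !mxE j0 j1.
rewrite (unsplitK (inl _ ord0 : 'I_1 + 'I_1)).
rewrite (unsplitK (inr _ ord0 : 'I_1 + 'I_1)).
rewrite !row_mxEl !row_mxEr expr0 mul1r expr1 mulN1r mulrN.
by rewrite -[ord0]/(0 : 'I_1).
Qed.

Lemma det_addmx_rank1_field (F : fieldType) r (M : 'M[F]_r) x (u : 'cV_r)
    (w : 'rV_r) :
  \det M != 0 ->
  \det (M + x *: (u *m w)) = \det M * (1 + x * (w *m invmx M *m u) 0 0).
Proof.
move=> nzM; rewrite scalemxAl det_addmx_mul // det_mx11 -scalemxAr.
by rewrite mxE [X in X + _]mxE eqxx [X in _ + X]mxE.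
Qed.

(** The two updates form a single one with two columns and two rows, which leaves a 2 by 2
    determinant. *)
Lemma det_addmx_rank2_field (F : fieldType) r (M : 'M[F]_r) x y
    (u1 u2 : 'cV_r) (w1 w2 : 'rV_r) (h := fun w u => (w *m invmx M *m u) 0 0) :
  \det M != 0 ->
  \det (M + x *: (u1 *m w1) + y *: (u2 *m w2)) =
  \det M * ((1 + x * h w1 u1) * (1 + y * h w2 u2)
            - x * y * (h w1 u2 * h w2 u1)).
Proof.
move=> nzM; rewrite -addrA !scalemxAl -mul_row_col det_addmx_mul //.
rewrite mul_col_mx mul_col_row -!scalemxAr (@scalar_mx_block _ 1 1).
rewrite add_block_mx det_block_mx11.
have E c (N : 'M[F]_1) z : (c%:M + z *: N) 0 0 = c + z * N 0 0.
  by rewrite mxE [X in X + _]mxE eqxx [X in _ + X]mxE.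
have E0 (N : 'M[F]_1) z : (0 + z *: N) 0 0 = z * N 0 0.
  by rewrite add0r mxE.
rewrite !E !E0 /h; congr (_ * _); ring.
Qed.


(** No inverse occurs in this form of the rank-one formula, so it can be specialised to singular
    matrices. *)
Lemma det_addmx_rank1_nz (R : idomainType) (F : fieldType)
    (f : {rmorphism R -> F}) r (M : 'M[R]_r) x
    (u : 'cV[R]_r) (w : 'rV[R]_r) :
  injective f -> \det M != 0 ->
  \det (M + x *: (u *m w)) =
  \det M + x * (\det (M + u *m w) - \det M).
Proof.
move=> f_inj nzM.
have nzfM : \det (map_mx f M) != 0 by rewrite det_map_mx raddf_eq0.
apply: f_inj; rewrite rmorphD rmorphM rmorphB -!det_map_mx.
rewrite !map_mxD map_mxZ map_mxM -[X in _ = _ + _ * (\det (_ + X) - _)]scale1r.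
rewrite !det_addmx_rank1_field //; ring.
Qed.

(** A form of Dodgson condensation: over [F], both sides are [x * y * (\det M)^2] times the mixed
    products [w1 M^-1 u2] and [w2 M^-1 u1]. The sign [e] makes room for the skew-Hermitian case. *)
Lemma det_addmx_rank2_nz (R : idomainType) (F : fieldType)
    (f : {rmorphism R -> F}) r (M : 'M[R]_r) x y e
    (u1 u2 : 'cV[R]_r) (w1 w2 : 'rV[R]_r) :
  injective f -> \det M != 0 -> e * e = 1 ->
  \det (M + x *: (u1 *m w1)) * \det (M + y *: (u2 *m w2))
    - \det M * \det (M + x *: (u1 *m w1) + y *: (u2 *m w2)) =
  x * y * (\det (M + u2 *m w1) - \det M)
    * (e * (\det (M + e *: (u1 *m w2)) - \det M)).
Proof.
move=> f_inj nzM e2.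
have nzfM : \det (map_mx f M) != 0 by rewrite det_map_mx raddf_eq0.
apply: f_inj; rewrite !(rmorphM, rmorphB) -!det_map_mx.
rewrite !(map_mxD, map_mxZ, map_mxM).
rewrite -[X in _ = _ * (\det (_ + X) - _) * _]scale1r.
rewrite det_addmx_rank2_field // !det_addmx_rank1_field //.
have fe2 : f e * f e = 1 by rewrite -rmorphM e2 rmorph1.
set d := \det _; set h11 := (map_mx f w1 *m _ *m map_mx f u1) 0 0.
set h12 := (map_mx f w1 *m _ *m map_mx f u2) 0 0.
set h21 := (map_mx f w2 *m _ *m map_mx f u1) 0 0.
set h22 := (map_mx f w2 *m _ *m map_mx f u2) 0 0.
transitivity (f x * f y * d * d * h12 * h21 * (f e * f e)); last by ring.
by rewrite fe2; ring.
Qed.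

Lemma tofrac_inj (R : idomainType) : injective (@tofrac R).
Proof. by move=> a b /eqP; rewrite tofrac_eq => /eqP. Qed.

(* Adding ['X] to the diagonal makes the determinant nonzero, and evaluation at
   [0] recovers [M]. *)
Section Perturbation.
Variables (R : idomainType) (r : nat) (M : 'M[R]_r).

Let Mt : 'M[{poly R}]_r := map_mx polyC M + 'X%:M.

Let Mt_nz : \det Mt != 0.
Proof.
have -> : Mt = char_poly_mx (- M) by rewrite /char_poly_mx map_mxN opprK addrC.
exact/monic_neq0/char_poly_monic.
Qed.

Let ev : {rmorphism {poly R} -> R} := horner_eval (0 : R).

Let evC (c : R) : ev c%:P = c.
Proof. exact: hornerC. Qed.

Let ev_mxC k l (N : 'M[R]_(k, l)) : map_mx ev (map_mx polyC N) = N.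
Proof. by apply/matrixP=> i j; rewrite !mxE evC. Qed.

Let evMt : map_mx ev Mt = M.
Proof.
rewrite map_mxD ev_mxC map_scalar_mx /=.
by rewrite [horner_eval _ _]hornerX raddf0 addr0.
Qed.

(** A pencil with variables removed can be singular, for instance when [A = 0] and fewer than [r]
    vectors remain, so invertibility has to go. *)
Lemma det_addmx_rank1 x (u : 'cV[R]_r) (w : 'rV[R]_r) :
  \det (M + x *: (u *m w)) =
  \det M + x * (\det (M + u *m w) - \det M).
Proof.
have := congr1 ev (@det_addmx_rank1_nz _ _ (@tofrac {poly R}) _ Mt x%:P
  (map_mx polyC u) (map_mx polyC w) (@tofrac_inj _) Mt_nz).
rewrite rmorphD rmorphM rmorphB -!det_map_mx.
by rewrite !(evMt, map_mxD, map_mxZ, map_mxM) !ev_mxC !evC.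
Qed.

Lemma det_addmx_rank2 x y e (u1 u2 : 'cV[R]_r) (w1 w2 : 'rV[R]_r) :
  e * e = 1 ->
  \det (M + x *: (u1 *m w1)) * \det (M + y *: (u2 *m w2))
    - \det M * \det (M + x *: (u1 *m w1) + y *: (u2 *m w2)) =
  x * y * (\det (M + u2 *m w1) - \det M)
    * (e * (\det (M + e *: (u1 *m w2)) - \det M)).
Proof.
move=> e2; have e2P : e%:P * e%:P = 1 by rewrite -polyCM e2.
have := congr1 ev (@det_addmx_rank2_nz _ _ (@tofrac {poly R}) _ Mt x%:P
  y%:P e%:P (map_mx polyC u1) (map_mx polyC u2) (map_mx polyC w1)
  (map_mx polyC w2) (@tofrac_inj _) Mt_nz e2P).
rewrite !(rmorphM, rmorphB) -!det_map_mx.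
by rewrite !(evMt, map_mxD, map_mxZ, map_mxM) !ev_mxC !evC.
Qed.

End Perturbation.

Lemma seq_argmin (T : eqType) d (O : orderType d) (F : T -> O) (s : seq T) x0 :
  x0 \in s -> exists2 x, x \in s & forall y, y \in s -> (F x <= F y)%O.
Proof.
elim: s x0 => // a [|b s] IHs x0 _.
  by exists a; rewrite ?mem_head // => y /[!inE] /eqP ->.
have [x xs minx] := IHs b (mem_head _ _).
have [le_ax|lt_xa] := leP (F a) (F x).
  exists a; first exact: mem_head.
  by move=> y; rewrite inE => /predU1P[-> //|/minx]; apply: le_trans.
exists x; first by rewrite inE xs orbT.
by move=> y; rewrite inE => /predU1P[->|/minx //]; apply: ltW.
Qed.

(** * Nonarchimedean valuations *)

Section Valuation.
Variables (R : realType) (K : fieldType) (nu : K -> \bar R).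
Hypothesis nuP : nonarchimedean_valuation nu.

Lemma nu_fin x : x != 0 -> exists a, nu x = a%:E.
Proof.
move=> nzx; case E : (nu x) => [a||]; first by exists a.
  by move/(valuation_eqy nuP): E => x0; rewrite x0 eqxx in nzx.
by have := valuation_neqNy nuP x; rewrite E.
Qed.

Lemma nu0 : nu 0 = +oo%E.
Proof. exact/(valuation_eqy nuP). Qed.

Lemma nu1 : nu 1 = 0%:E.
Proof.
have [a E] := nu_fin (oner_neq0 K).
have := valuationM nuP 1 1; rewrite mulr1 E -EFinD => -[aa].
by congr (_%:E); lra.
Qed.

Lemma nuN x : nu (- x) = nu x.
Proof.
have nzN1 : -1 != 0 :> K by rewrite oppr_eq0 oner_neq0.
have [a E] := nu_fin nzN1.
have := valuationM nuP (-1) (-1); rewrite mulrNN mulr1 nu1 E -EFinD => -[aa].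
by rewrite -mulN1r (valuationM nuP) E (_ : a = 0) ?add0e //; lra.
Qed.

Lemma nu_sum_gt (I : finType) (P : pred I) (F : I -> K) c :
  (forall i, P i -> (c%:E < nu (F i))%E) -> (c%:E < nu (\sum_(i | P i) F i))%E.
Proof.
move=> cF; apply: (big_ind (fun z => c%:E < nu z)%E) => //.
  by rewrite nu0 ltry.
move=> x y cx cy; apply: lt_le_trans (valuationD nuP x y).
by rewrite lt_min cx.
Qed.

Lemma nu_sum_ge (I : finType) (P : pred I) (F : I -> K) c :
  (forall i, P i -> (c%:E <= nu (F i))%E) ->
  (c%:E <= nu (\sum_(i | P i) F i))%E.
Proof.
move=> cF; apply: (big_ind (fun z => c%:E <= nu z)%E) => //.
  by rewrite nu0 leey.
move=> x y cx cy; apply: le_trans (valuationD nuP x y).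
by rewrite le_min cx.
Qed.

(** If the sum had valuation above [c], so would [F i0], which is the sum minus the other terms. *)
Lemma nu_sum_dominant (I : finType) (P : pred I) (F : I -> K) c i0 :
  P i0 -> (nu (F i0) <= c%:E)%E ->
  (forall i, P i -> i != i0 -> (c%:E < nu (F i))%E) ->
  (nu (\sum_(i | P i) F i) <= c%:E)%E.
Proof.
move=> Pi0 ci0 cF; rewrite (bigD1 i0) //= leNgt; apply/negP => c_sum.
have c_rest : (c%:E < nu (\sum_(i | P i && (i != i0)) F i))%E.
  by apply: nu_sum_gt => i /andP[]; exact: cF.
suff : (c%:E < nu (F i0))%E by rewrite ltNge ci0.
rewrite -[F i0](addrK (\sum_(i | P i && (i != i0)) F i)).
by apply: lt_le_trans (valuationD nuP _ _); rewrite lt_min c_sum nuN.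
Qed.

Lemma nuM_ge x y c d : (c%:E <= nu x)%E -> (d%:E <= nu y)%E ->
  ((c + d)%:E <= nu (x * y)%R)%E.
Proof. by move=> cx dy; rewrite (valuationM nuP) EFinD leeD. Qed.

Lemma nuM_gtl x y c d : (c%:E < nu x)%E -> (d%:E <= nu y)%E ->
  ((c + d)%:E < nu (x * y)%R)%E.
Proof. by move=> cx dy; rewrite (valuationM nuP) EFinD lte_leD. Qed.

Lemma nuM_gtr x y c d : (c%:E <= nu x)%E -> (d%:E < nu y)%E ->
  ((c + d)%:E < nu (x * y)%R)%E.
Proof. by move=> cx dy; rewrite mulrC addrC nuM_gtl. Qed.

(** * Least weighted terms of products *)

Section Weights.
Variables (n : nat) (om : 'I_n -> R).
Implicit Types (U V C : multinom n) (f g h : mpoly n K).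

(** Bounds are stated as [m - weight U <= nu (mcoeff U f)], which keeps the weights on the real
    side, away from infinite valuations. *)
Definition weight U : R := \sum_i om i * (U i)%:R.

Lemma weightD U V : weight (mnm_add U V) = weight U + weight V.
Proof.
by rewrite -big_split; apply: eq_bigr => i _; rewrite mnmDE natrD mulrDr.
Qed.

Lemma weight1 i : weight (mnm1 i) = om i.
Proof.
rewrite /weight (bigD1 i) //= mnm1E eqxx mulr1 big1 ?addr0 // => j ji.
by rewrite mnm1E eq_sym (negbTE ji) mulr0.
Qed.

(** The index type is the one in [mcoeffM]. A general [t] lets a difference of two products be a
    single sum. *)
Let conv (t : multinom n -> multinom n -> K) M :=
  \sum_(k : bmultinom n (mdeg M).+1 * bmultinom n (mdeg M).+1
        | M == mnm_add k.1 k.2) t k.1 k.2.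

Lemma nu_conv_gt t M c :
  (forall U V, M = mnm_add U V -> (c%:E < nu (t U V))%E) ->
  (c%:E < nu (conv t M))%E.
Proof. by move=> ct; apply: nu_sum_gt => k /eqP; exact: ct. Qed.

Lemma nu_conv_dominant t U0 V0 c (M := mnm_add U0 V0) :
  (nu (t U0 V0) <= c%:E)%E ->
  (forall U V, M = mnm_add U V -> (U, V) != (U0, V0) ->
     (c%:E < nu (t U V))%E) ->
  (nu (conv t M) <= c%:E)%E.
Proof.
move=> c0 ct.
have bU : (mdeg U0 < (mdeg M).+1)%N by rewrite /M mdegD ltnS leq_addr.
have bV : (mdeg V0 < (mdeg M).+1)%N by rewrite /M mdegD ltnS leq_addl.
apply: (@nu_sum_dominant _ _ _ _ (BMultinom bU, BMultinom bV)) => //.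
move=> [U V] /eqP /ct /= c1 ne; apply: c1; apply: contra ne => /eqP [EU EV].
by apply/eqP; congr (_, _); apply: val_inj.
Qed.

(* The coefficients of [g * h] of least weighted valuation cannot all cancel:
   breaking ties by the monomial order singles out a square monomial. *)
Lemma gauss_square g h : g != 0 ->
  (forall U, nu (mcoeff U h) = nu (mcoeff U g)) ->
  exists N C,
    (forall U, ((N - weight U)%:E <= nu (mcoeff U g))%E) /\
    (nu (mcoeff (mnm_add C C) (g * h))
       <= (N + N - weight (mnm_add C C))%:E)%E.
Proof.
(* [fine] sends the infinite valuation to [0], so [W] is meaningful only on the support of [g]. *)
move=> nzg eq_hg; pose W U := fine (nu (mcoeff U g)) + weight U.
have nuW U : U \in msupp g -> nu (mcoeff U g) = (W U - weight U)%:E.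
  rewrite mcoeff_msupp => /nu_fin[a E].
  by rewrite /W E /= addrK.
have [U0 U0g] : exists U, U \in msupp g.
  exists (mlead g); exact: mlead_supp.
have [C1 C1g minC1] := seq_argmin W U0g.
have C1s : C1 \in [seq U <- msupp g | W U == W C1].
  by rewrite mem_filter eqxx.
have [C] := seq_argmin id C1s; rewrite mem_filter => /andP[/eqP WC Cg] minC.
exists (W C1), C.
have geN U : ((W C1 - weight U)%:E <= nu (mcoeff U g))%E.
  have [Ug|] := boolP (U \in msupp g); last first.
    by rewrite -mcoeff_eq0 => /eqP ->; rewrite nu0 leey.
  by rewrite nuW // lee_fin lerB // minC1.
have gtN U : (U < C)%O -> ((W C1 - weight U)%:E < nu (mcoeff U g))%E.
  move=> ltUC; have [Ug|] := boolP (U \in msupp g); last first.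
    by rewrite -mcoeff_eq0 => /eqP ->; rewrite nu0 ltry.
  rewrite nuW // lte_fin ltrD2r lt_neqAle minC1 // andbT.
  apply: contraTneq ltUC => WU; rewrite -leNgt; apply: minC.
  by rewrite mem_filter -WU eqxx.
split=> //; rewrite mcoeffM.
apply: (@nu_conv_dominant (fun U V => mcoeff U g * mcoeff V h)).
  rewrite (valuationM nuP) eq_hg nuW // WC -EFinD lee_fin weightD; lra.
(* A pair with sum [C + C] other than [(C, C)] has a member strictly below [C], whose coefficient is
   strictly above the bound. *)
move=> U V EUV; have [ltUC _|leCU] := ltP U C.
  rewrite (_ : _ - _ = (W C1 - weight U) + (W C1 - weight V)); last first.
    by rewrite EUV weightD; ring.
  by apply: nuM_gtl; rewrite ?eq_hg; [exact: gtN|exact: geN].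
have [ltVC _|leCV] := ltP V C.
  rewrite (_ : _ - _ = (W C1 - weight U) + (W C1 - weight V)); last first.
    by rewrite EUV weightD; ring.
  by apply: nuM_gtr; rewrite ?eq_hg; [exact: geN|exact: gtN].
case/negP; apply/eqP; move: leCU leCV; rewrite !le_eqVlt.
move=> /predU1P[EU|ltCU] /predU1P[EV|ltCV]; first by rewrite -EU -EV.
- by have := lemc_lt_add (lexx C) ltCV; rewrite EUV EU ltxx.
- by have := ltmc_le_add ltCU (lexx C); rewrite EUV EV ltxx.
- by have := ltm_add ltCU ltCV; rewrite EUV ltxx.
Qed.

(** Least terms of [f * f] come from the pairs on [A] and [B]. The difference kills [(A, A)] and
    [(B, B)] and keeps exactly one of [(A, B)] and [(B, A)], so its unique least monomial is
    [A + B]. The square monomial found in [g * h], shifted by [x_i x_j], is least too and must be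
    the same. *)
Lemma two_term_square f Fi Fj F0 g h (A B : multinom n) i j m :
  (A i + B i = 1)%N -> (A j + B j = 1)%N ->
  nu (mcoeff A f) = (m - weight A)%:E -> nu (mcoeff B f) = (m - weight B)%:E ->
  (forall U, U != A -> U != B -> ((m - weight U)%:E < nu (mcoeff U f))%E) ->
  (forall U, mcoeff U Fi = if U j == 0%N then mcoeff U f else 0) ->
  (forall U, mcoeff U Fj = if U i == 0%N then mcoeff U f else 0) ->
  (forall U, mcoeff U F0 =
     if (U i == 0%N) && (U j == 0%N) then mcoeff U f else 0) ->
  Fi * Fj - F0 * f = g * h * mpolyX K (mnm_add (mnm1 i) (mnm1 j)) ->
  (forall U, nu (mcoeff U h) = nu (mcoeff U g)) ->
  exists C, mnm_add A B = mnm_add (mnm_add (mnm1 i) (mnm1 j)) (mnm_add C C).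
Proof.
move=> ABi ABj nuA nuB nuU cFi cFj cF0 defH eq_hg.
(* The net multiplicity of [(U, V)] in the difference: [Fi * Fj] keeps the pair when [x_j] is absent
   from [U] and [x_i] from [V], and [F0 * f] when both are absent from [U]. *)
pose s (U V : multinom n) : K :=
  ((U j == 0) && (V i == 0))%N%:R - ((U i == 0) && (U j == 0))%N%:R.
pose t U V := s U V * (mcoeff U f * mcoeff V f).
have HE M : mcoeff M (Fi * Fj - F0 * f) = conv t M.
  rewrite mcoeffB !mcoeffM -sumrB; apply: eq_bigr => -[[U bU] [V bV]] _ /=.
  rewrite cFi cFj cF0 /t /s.
  case: (U j == 0%N); case: (V i == 0%N); case: (U i == 0%N) => /=;
  by rewrite ?(mulr0n, mulr1n) ?(subr0, sub0r, subrr)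
             ?(mul0r, mulr0, mul1r, mulN1r) ?(subr0, sub0r, oppr0).
have nus U V c : (c%:E < nu (mcoeff U f * mcoeff V f))%E ->
    (c%:E < nu (t U V))%E.
  move=> cUV; rewrite /t /s; do 2 case: (_ && _).
  - by rewrite subrr mul0r nu0 ltry.
  - by rewrite subr0 mulr1n mul1r.
  - by rewrite sub0r mulr1n mulN1r nuN.
  - by rewrite subrr mul0r nu0 ltry.
have nuU_ge U : ((m - weight U)%:E <= nu (mcoeff U f))%E.
  have [->|UA] := eqVneq U A; first by rewrite nuA.
  have [->|UB] := eqVneq U B; first by rewrite nuB.
  exact/ltW/nuU.
have diag U : t U U = 0.
  by rewrite /t /s andbC subrr mul0r.
have small U V : U != A -> U != B ->
    ((m + m - weight (mnm_add U V))%:E < nu (t U V))%E.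
  move=> UA UB; apply: nus.
  rewrite (_ : _ - _ = (m - weight U) + (m - weight V)); last first.
    by rewrite weightD; ring.
  by apply: nuM_gtl; [exact: nuU|exact: nuU_ge].
have smallr U V : V != A -> V != B ->
    ((m + m - weight (mnm_add U V))%:E < nu (t U V))%E.
  move=> UA UB; apply: nus.
  rewrite (_ : _ - _ = (m - weight U) + (m - weight V)); last first.
    by rewrite weightD; ring.
  by apply: nuM_gtr; [exact: nuU_ge|exact: nuU].
have H_small M : M != mnm_add A B ->
    ((m + m - weight M)%:E < nu (mcoeff M (Fi * Fj - F0 * f)))%E.
  move=> MAB; rewrite HE; apply: nu_conv_gt => U V EM.
  have [EUA|UA] := eqVneq U A.
    have [EVA|VA] := eqVneq V A; first by rewrite EUA EVA diag nu0 ltry.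
    have [EVB|VB] := eqVneq V B; first by rewrite EM EUA EVB eqxx in MAB.
    by rewrite EM; apply: smallr.
  have [EUB|UB] := eqVneq U B; last by rewrite EM; apply: small.
  have [EVA|VA] := eqVneq V A; first by rewrite EM EUB EVA addmC eqxx in MAB.
  have [EVB|VB] := eqVneq V B; first by rewrite EUB EVB diag nu0 ltry.
  by rewrite EM; apply: smallr.
have H_big : (nu (mcoeff (mnm_add A B) (Fi * Fj - F0 * f))
              <= (m + m - weight (mnm_add A B))%:E)%E.
  have dominant U V : U = A /\ V = B \/ U = B /\ V = A ->
      s U V = 1 \/ s U V = -1 -> s V U = 0 ->
      (nu (conv t (mnm_add U V)) <= (m + m - weight (mnm_add U V))%:E)%E.
    move=> UV sUV sVU; apply: nu_conv_dominant.
      rewrite (_ : nu (t U V) = nu (mcoeff U f * mcoeff V f)); last first.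
        by rewrite /t; case: sUV => ->; rewrite ?mul1r // mulN1r nuN.
      rewrite (valuationM nuP) weightD.
      by case: UV => -[-> ->]; rewrite nuA nuB -EFinD lee_fin; lra.
    have zVU : t V U = 0 by rewrite /t sVU mul0r.
    move=> U' V' ->; have [UA|UA] := eqVneq U' A; last first.
      have [UB|UB] := eqVneq U' B; last by move=> _; apply: small.
      have [VB|VB] := eqVneq V' B; first by rewrite UB VB diag nu0 ltry.
      have [VA|VA] := eqVneq V' A; last by move=> _; apply: smallr.
      rewrite UB VA; case: UV zVU => -[-> ->]; last by rewrite eqxx.
      by move=> -> _; rewrite nu0 ltry.
    have [VA|VA] := eqVneq V' A; first by rewrite UA VA diag nu0 ltry.
    have [VB|VB] := eqVneq V' B; last by move=> _; apply: smallr.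
    rewrite UA VB; case: UV zVU => -[-> ->]; first by rewrite eqxx.
    by move=> -> _; rewrite nu0 ltry.
  rewrite HE.
  (* If [A] agrees at [i] and [j], the surviving pair comes from [F0 * f] with sign [-1]; otherwise
     it comes from [Fi * Fj] with sign [1]. [addmC] puts that pair in the order [dominant]
     expects. *)
  have [[Ai Bi]|[Ai Bi]] : (A i = 0 /\ B i = 1 \/ A i = 1 /\ B i = 0)%N by lia.
    have [[Aj Bj]|[Aj Bj]] : (A j = 0 /\ B j = 1 \/ A j = 1 /\ B j = 0)%N.
    - by lia.
    - by apply: dominant; rewrite /s ?Ai ?Aj ?Bi ?Bj /=
        ?mulr1n ?mulr0n ?subrr ?sub0r; auto.
    - rewrite addmC; by apply: dominant; rewrite /s ?Ai ?Aj ?Bi ?Bj /=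
        ?mulr1n ?mulr0n ?subrr ?subr0; auto.
  have [[Aj Bj]|[Aj Bj]] : (A j = 0 /\ B j = 1 \/ A j = 1 /\ B j = 0)%N by lia.
    by apply: dominant; rewrite /s ?Ai ?Aj ?Bi ?Bj /=
        ?mulr1n ?mulr0n ?subrr ?subr0; auto.
  rewrite addmC; by apply: dominant; rewrite /s ?Ai ?Aj ?Bi ?Bj /=
        ?mulr1n ?mulr0n ?subrr ?sub0r; auto.
have nzH : mcoeff (mnm_add A B) (Fi * Fj - F0 * f) != 0.
  by apply: contraTneq H_big => ->; rewrite nu0 -ltNge ltry.
have nzg : g != 0.
  by apply: contraNneq nzH => g0; rewrite defH g0 !mul0r mcoeff0.
have [N [C [geN leC]]] := gauss_square nzg eq_hg.
exists C; apply/eqP; apply: contraTT leC => neC; rewrite -ltNge.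
have : mnm_add A B \in msupp (g * h * mpolyX K (mnm_add (mnm1 i) (mnm1 j))).
  by rewrite mcoeff_msupp -defH.
rewrite (perm_mem (msuppMX _ _)) => /mapP[L _ EL].
(* The coefficient of [A + B] is bounded below through [g] and [h], and above by [H_big]. *)
have leN : N + N <= m + m - om i - om j.
  have : ((N + N - weight L)%:E
          <= (m + m - weight (mnm_add A B))%:E :> \bar R)%E.
    apply: le_trans H_big; rewrite defH EL mcoeffMX mcoeffM.
    apply: nu_sum_ge => -[[U bU] [V bV]] /= /eqP ->.
    rewrite (_ : _ - _ = (N - weight U) + (N - weight V)); last first.
      by rewrite weightD; ring.
    by apply: nuM_ge; rewrite ?eq_hg.
  by rewrite EL !weightD !weight1 lee_fin; lra.
rewrite eq_sym in neC; have := H_small _ neC; rewrite defH mcoeffMX.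
apply: le_lt_trans; rewrite lee_fin !weightD !weight1; lra.
Qed.

End Weights.
End Valuation.

(** * Semilinear substitutions in polynomials *)

Section Twist.
Variables (K : fieldType) (n : nat).
Variables (phi : {rmorphism K -> K}) (e : 'I_n -> K).

(** One map serves two purposes: with [phi = idfun] and [e] valued in 0 and 1 it sets variables to
    zero; with [phi = bar] it extends the involution to polynomials. *)
Definition twist : {rmorphism mpoly n K -> mpoly n K} :=
  mmap (mpolyC n (R:=K) \o phi) (fun k => mpolyC n (e k) * mpolyX K (mnm1 k)).

Lemma twistX k : twist (mpolyX K (mnm1 k)) = mpolyC n (e k) * mpolyX K (mnm1 k).
Proof. by rewrite /= mmapX mmap1U. Qed.

Lemma twistC c : twist (mpolyC n c) = mpolyC n (phi c).
Proof. by rewrite /= mmapC. Qed.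

Lemma map_twistC k l (N : 'M[K]_(k, l)) :
  map_mx twist (map_mx (mpolyC n (R:=K)) N) =
  map_mx (mpolyC n (R:=K)) (map_mx phi N).
Proof. by apply/matrixP => a b; rewrite !mxE -twistC. Qed.

(** Each monomial is sent to a scalar multiple of itself, so coefficients do not mix. *)
Lemma mcoeff_twist U p :
  mcoeff U (twist p) = phi (mcoeff U p) * \prod_k e k ^+ U k.
Proof.
rewrite /= /mmap raddf_sum /=.
have E m : mcoeff U (mpolyC n (phi (mcoeff m p)) *
    mmap1 (fun k => mpolyC n (e k) * mpolyX K (mnm1 k)) m) =
    phi (mcoeff m p) * (\prod_k e k ^+ m k) * (m == U)%:R.
  rewrite mcoeffCM /mmap1 -mulrA; congr (_ * _).
  under [X in mcoeff _ X]eq_bigr do rewrite exprMn -rmorphXn.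
  by rewrite big_split -rmorph_prod mcoeffCM -mpolyXE_id mcoeffX.
under eq_bigr do rewrite E.
have [Up|] := boolP (U \in msupp p).
  rewrite (bigD1_seq U) ?msupp_uniq //= eqxx mulr1.
  rewrite [X in _ + X]big1 ?addr0 // => m.
  by move=> /negbTE ->; rewrite mulr0.
move=> Up; rewrite big1_seq; last first.
  move=> m /andP[_ mp]; rewrite (_ : m == U = false) ?mulr0 //.
  by apply: contraNF Up => /eqP <-.
by move: Up; rewrite -mcoeff_eq0 => /eqP ->; rewrite rmorph0 mul0r.
Qed.

End Twist.

(** Since [0 ^+ 0 = 1], a factor vanishes only when a variable in [P] occurs in [U]. *)
Lemma prod_exp_predC (K : fieldType) n (U : multinom n) (P : pred 'I_n) :
  \prod_k ((~~ P k)%:R : K) ^+ U k = [forall (k | P k), U k == 0%N]%:R.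
Proof.
have [/forall_inP U0|] := boolP [forall (k | P k), U k == 0%N].
  rewrite big1 // => k _; case: (boolP (P k)) => Pk; last by rewrite expr1n.
  by rewrite (eqP (U0 k Pk)) expr0.
rewrite negb_forall_in => /exists_inP[k Pk Uk].
by rewrite (bigD1 k) //= Pk expr0n (negbTE Uk) mul0r.
Qed.

(** * The matrix pencil and the removal of variables *)

Section Pencil.
Variables (K : fieldType) (n r : nat) (A : 'M[K]_r).
Variables (v : 'I_n -> 'cV[K]_r) (w : 'I_n -> 'rV[K]_r).

Local Notation C := (mpolyC n (R:=K)).
Local Notation Xi k := (mpolyX K (mnm1 k)).

Definition pencil (e : 'I_n -> K) : 'M[mpoly n K]_r :=
  \sum_k (C (e k) * Xi k) *: map_mx C (v k *m w k) + map_mx C A.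

Definition without (P : pred 'I_n) : 'M[mpoly n K]_r :=
  pencil (fun k => (~~ P k)%:R).

Lemma twist_without (P Q : pred 'I_n) :
  map_mx (twist idfun (fun k => (~~ Q k)%:R)) (without P) =
  without (predU P Q).
Proof.
rewrite /without /pencil map_mxD map_mx_sum map_twistC map_mx_id //.
congr (_ + _).
apply: eq_bigr => k _; rewrite map_mxZ map_twistC map_mx_id //; congr (_ *: _).
rewrite rmorphM twistC twistX mulrA -rmorphM.
by congr (C _ * _); rewrite -natrM mulnb -negb_or.
Qed.

Lemma twist_update (P Q : pred 'I_n) (u : 'cV[K]_r) (z : 'rV[K]_r) :
  map_mx (twist idfun (fun k => (~~ Q k)%:R))
    (without P + map_mx C u *m map_mx C z) =
  without (predU P Q) + map_mx C u *m map_mx C z.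
Proof.
by rewrite map_mxD twist_without map_mxM !map_twistC !map_mx_id.
Qed.

Lemma without_split (P : pred 'I_n) i : ~~ P i ->
  without P =
  without (predU P (pred1 i)) + Xi i *: (map_mx C (v i) *m map_mx C (w i)).
Proof.
move=> Pi; rewrite /without /pencil (bigD1 i) //= [in RHS](bigD1 i) //=.
rewrite Pi eqxx orbT rmorph1 mul1r rmorph0 mul0r scale0r add0r -map_mxM.
rewrite -addrA addrC; congr (_ + _ + _); apply: eq_bigr => k ki.
by rewrite (negbTE ki) orbF.
Qed.

Lemma eq_without (P Q : pred 'I_n) : P =1 Q -> without P = without Q.
Proof.
by move=> PQ; rewrite /without /pencil; under eq_bigr do rewrite PQ.
Qed.

(** The determinant commutes with setting the variables of [Q] to zero, which keeps exactly the
    monomials that avoid [Q]. *)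
Lemma mcoeff_without (Q : pred 'I_n) U :
  mcoeff U (\det (without Q)) =
  if [forall (k | Q k), U k == 0%N] then mcoeff U (\det (without pred0)) else 0.
Proof.
have <- : without (predU pred0 Q) = without Q by apply: eq_without.
rewrite -twist_without det_map_mx mcoeff_twist prod_exp_predC /=.
by case: ifP; rewrite ?mulr1 ?mulr0.
Qed.

(** Invariance under [x_i = 0] is how the absence of [x_i] from a determinant gets proved. *)
Lemma msupp_fixed i (p : mpoly n K) U :
  twist idfun (fun k => (~~ pred1 i k)%:R) p = p ->
  U \in msupp p -> U i = 0%N.
Proof.
move=> fixp; rewrite mcoeff_msupp -fixp mcoeff_twist prod_exp_predC.
case: forall_inP => [U0 _|_]; last by rewrite mulr0 eqxx.
by apply/eqP/U0; rewrite inE.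
Qed.

(** The variable [x_i] enters through a rank-one update, so the determinant is affine in it. *)
Lemma det_pencil_multiaffine U i :
  U \in msupp (\det (without pred0)) -> (U i <= 1)%N.
Proof.
rewrite (@without_split pred0 i) // det_addmx_rank1.
set M := without _.
have fixM : map_mx (twist idfun (fun k => (~~ pred1 i k)%:R)) M = M.
  by rewrite /M twist_without; apply: eq_without => k /=; rewrite orbb.
have fixMu : map_mx (twist idfun (fun k => (~~ pred1 i k)%:R))
    (M + map_mx C (v i) *m map_mx C (w i)) =
    M + map_mx C (v i) *m map_mx C (w i).
  rewrite /M twist_update; congr (_ + _).
  by apply: eq_without => k /=; rewrite orbb.
move/msuppD_le; rewrite mem_cat => /orP[].
  by move/(@msupp_fixed i) => -> //; rewrite -det_map_mx fixM.
rewrite mulrC (perm_mem (msuppMX _ _)) => /mapP[L /(@msupp_fixed i) L0 ->].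
rewrite mnmDE mnm1E eqxx L0 //.
by rewrite rmorphB -!det_map_mx fixM fixMu.
Qed.

End Pencil.

(** * Hermitian symmetry and condensation *)

Section DetPoly.
Variables (R : realType) (K : fieldType) (nu : K -> \bar R).
Hypothesis nuP : nonarchimedean_valuation nu.
Variables (bar : {rmorphism K -> K}) (r n : nat) (A : 'M[K]_r).
Variable v : 'I_n -> 'cV[K]_r.
Hypothesis barK : involutive bar.
Hypothesis nu_bar : forall a, nu (bar a) = nu a.

Let w i : 'rV[K]_r := (map_mx bar (v i))^T.
Local Notation C := (mpolyC n (R:=K)).
Local Notation Xi k := (mpolyX K (mnm1 k)).
Let f := det_poly bar A v.

Lemma det_polyE : f = \det (without A v w pred0).
Proof.
apply: (congr1 (fun S => \det (S + map_mx C A))).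
by apply: eq_bigr => k _; rewrite rmorph1 mul1r.
Qed.

Lemma nu_mul_sqrt1 e x : e * e = 1 -> nu (e * x) = nu x.
Proof.
move=> e2; have nze : e != 0.
  by apply: contra_eq_neq e2 => ->; rewrite mulr0 eq_sym oner_neq0.
have [a E] := nu_fin nuP nze.
have := valuationM nuP e e; rewrite e2 (nu1 nuP) E -EFinD => -[aa].
by rewrite (valuationM nuP) E (_ : a = 0) ?add0e //; lra.
Qed.

Lemma bar_w i : map_mx bar (w i) = (v i)^T.
Proof. by apply/matrixP => a b; rewrite !mxE barK. Qed.

Section Hermitian.
Variable e : K.
Hypotheses (e2 : e * e = 1) (barA : map_mx bar A = e *: A^T).

(* For [e = -1] the involution is extended to polynomials by [x_k |-> - x_k],
   which turns a skew-Hermitian pencil into minus its transpose. *)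
Let tau := twist bar (fun _ : 'I_n => e).

(** Conjugation turns each [v k *m w k] into its transpose, while the variables and [A] each
    contribute a factor [e]. *)
Lemma tau_without P : map_mx tau (without A v w P) = C e *: (without A v w P)^T.
Proof.
rewrite /without /pencil map_mxD map_mx_sum linearD scalerDr map_twistC barA.
congr (_ + _); last by rewrite /= map_trmx map_mxZ.
rewrite linear_sum scaler_sumr; apply: eq_bigr => k _ /=.
rewrite map_mxZ map_twistC map_mxM bar_w linearZ /= scalerA.
congr (_ *: _); last first.
  by rewrite map_trmx trmx_mul trmxK.
by rewrite rmorphM twistC twistX rmorph_nat mulrCA.
Qed.

(** The update by [v j] and [w i] becomes the transpose of the one by [v i] and [w j]. Pulling [C e]
    out of the matrix gives [C e ^+ r] and, as [e * e = 1], leaves an [e] on the update. *)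
Lemma tau_det_update P i j :
  tau (\det (without A v w P + map_mx C (v j) *m map_mx C (w i))) =
  C e ^+ r * \det (without A v w P + C e *: (map_mx C (v i) *m map_mx C (w j))).
Proof.
rewrite -det_map_mx map_mxD tau_without map_mxM !map_twistC bar_w.
rewrite -detZ scalerDr scalerA -rmorphM e2 rmorph1 scale1r -det_tr.
congr (\det _); rewrite [RHS]linearD /= [X in _ = X + _]linearZ /= trmx_mul.
congr (_ + _).
by rewrite /= !map_trmx trmxK.
Qed.

Lemma tau_det P :
  tau (\det (without A v w P)) = C e ^+ r * \det (without A v w P).
Proof. by rewrite -det_map_mx tau_without detZ det_tr. Qed.

(** Condensation is applied to the pencil [M] without [x_i] and [x_j]. Its two factors use the mixed
    updates [v j *m w i] and [v i *m w j], which [tau] exchanges up to signs. *)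
Lemma rayleigh_difference i j : i != j ->
  exists g h : mpoly n K,
    \det (without A v w (pred1 j)) * \det (without A v w (pred1 i))
      - \det (without A v w (predU (pred1 i) (pred1 j)))
        * \det (without A v w pred0)
      = g * h * mpolyX K (mnm_add (mnm1 i) (mnm1 j)) /\
    forall L, nu (mcoeff L h) = nu (mcoeff L g).
Proof.
move=> ij; have ji := ij; rewrite eq_sym in ji.
have Mi := without_split A v w (ij : ~~ pred1 j i).
have Mj := without_split A v w (ji : ~~ pred1 i j).
have Mij := without_split A v w (isT : ~~ pred0 j).
have Eij : without A v w (predU (pred1 j) (pred1 i)) =
           without A v w (predU (pred1 i) (pred1 j)).
  by apply: eq_without => k /=; rewrite orbC.
have E0 : without A v w (predU pred0 (pred1 j)) = without A v w (pred1 j).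
  exact: eq_without.
rewrite Eij in Mi; rewrite E0 Mi in Mij; rewrite {}Mi {}Mj {}Mij.
have := tau_det_update (predU (pred1 i) (pred1 j)) i j.
have := tau_det (predU (pred1 i) (pred1 j)).
move: (without A v w _) => M tauM tauMu {Eij E0}.
have Ce2 : C e * C e = 1 by rewrite -rmorphM e2 rmorph1.
rewrite (det_addmx_rank2 M _ _ _ _ _ _ Ce2) mpolyXD.
move: tauM tauMu.
set dM := \det M; set du := \det _; set du' := \det _ => tauM tauMu.
exists (du - dM), (C e * (du' - dM)); split; first by rewrite -mulrA mulrC.
move=> L.
(* [tau] multiplies both determinants by [C e ^+ r], which is its own inverse. *)
have -> : C e * (du' - dM) = C (e * e ^+ r) * tau (du - dM).
  rewrite rmorphB tauM tauMu -mulrBr mulrA -rmorphXn -rmorphM.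
  by rewrite -mulrA -exprMn e2 expr1n mulr1.
rewrite mcoeffCM mcoeff_twist nu_mul_sqrt1; last first.
  by rewrite mulrACA e2 mul1r -exprMn e2 expr1n.
rewrite mulrC nu_mul_sqrt1 ?nu_bar // -big_split big1 //= => k _.
by rewrite -exprMn e2 expr1n.
Qed.

Lemma det_poly_minimizers (om : 'I_n -> R) (U V : multinom n) m i j :
  i != j -> (U i + V i = 1)%N -> (U j + V j = 1)%N ->
  nu (mcoeff U f) = (m - weight om U)%:E ->
  nu (mcoeff V f) = (m - weight om V)%:E ->
  (forall L, L != U -> L != V ->
     ((m - weight om L)%:E < nu (mcoeff L f))%E) ->
  exists L, mnm_add U V = mnm_add (mnm_add (mnm1 i) (mnm1 j)) (mnm_add L L).
Proof.
move=> ij UVi UVj nuU nuV nuL.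
have [g [h [gh nu_gh]]] := rayleigh_difference ij.
rewrite -det_polyE in gh.
apply: (two_term_square nuP UVi UVj nuU nuV nuL _ _ _ gh nu_gh) => L.
- rewrite mcoeff_without -det_polyE; congr (if _ then _ else _).
  apply/forall_inP/eqP => [L0|L0 k /eqP ->]; last by rewrite L0.
  by apply/eqP/L0; rewrite inE.
- rewrite mcoeff_without -det_polyE; congr (if _ then _ else _).
  apply/forall_inP/eqP => [L0|L0 k /eqP ->]; last by rewrite L0.
  by apply/eqP/L0; rewrite inE.
- rewrite mcoeff_without -det_polyE; congr (if _ then _ else _).
  apply/forall_inP/andP => [L0|[Li Lj] k]; last first.
    by rewrite !inE => /orP[] /eqP ->.
  by split; apply: L0; rewrite !inE eqxx ?orbT.
Qed.

End Hermitian.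
End DetPoly.

(** * Edges of the induced subdivision *)

Section Edges.
Variables (R : realType) (n : nat).

Lemma subset_convex_hull (V : lmodType R) (X : set V) x :
  X x -> convex_hull X x.
Proof.
move=> Xx; exists 1%N, (fun=> 1), (fun=> x); split=> //.
- by rewrite big_ord1.
- by rewrite big_ord1 scale1r.
Qed.

Lemma segmentP (V : lmodType R) (a b x : V) : segment a b x ->
  exists s, [/\ 0 <= s, s <= 1 & x = a + s *: (b - a)].
Proof.
(* The parameter is the total weight put on [b]. *)
move=> [k [t [c [t0 t1 cab ->]]]]; exists (\sum_(i | c i == b) t i); split.
- by apply: sumr_ge0 => i _; apply: t0.
- rewrite -t1 [leRHS](bigID (fun i => c i == b)) /= lerDl.
  by apply: sumr_ge0 => i _; apply: t0.
have E i : t i *: c i = t i *: a + (if c i == b then t i else 0) *: (b - a).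
  case: eqP => [->|cb]; first by rewrite -scalerDr addrC subrK.
  by rewrite scale0r addr0; case: (cab i) => [->|/cb].
under eq_bigr do rewrite E.
by rewrite big_split /= -scaler_suml t1 scale1r -scaler_suml -big_mkcond.
Qed.

Lemma segmentC (V : lmodType R) (a b : V) : segment a b = segment b a.
Proof. by rewrite /segment setUC. Qed.

Lemma dotp_sum m (w : 'rV[R]_m) k (t : 'I_k -> R) (z : 'I_k -> 'rV[R]_m) :
  dotp w (\sum_i t i *: z i) = \sum_i t i * dotp w (z i).
Proof.
rewrite /dotp; under [RHS]eq_bigr do rewrite mulr_sumr.
rewrite exchange_big; apply: eq_bigr => l _ /=.
rewrite summxE mulr_sumr; apply: eq_bigr => i _.
by rewrite mxE mulrCA.
Qed.

Lemma indicator_inj : injective (@indicator R n).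
Proof.
move=> S T /rowP ST; apply/setP => i; have := ST i; rewrite !mxE => /eqP.
by rewrite eqr_nat; case: (i \in S); case: (i \in T).
Qed.

Variable p : {set 'I_n} -> \bar R.
Hypothesis p_neqNy : forall S, p S != -oo%E.

Let lifted S : 'rV[R]_(n + 1) := row_mx (indicator R S) (fine (p S))%:M.

Lemma dotp_lift (w : 'rV[R]_(n + 1)) S : dotp w (lifted S) =
  \sum_(i in S) lsubmx w 0 i + rsubmx w 0 0 * fine (p S).
Proof.
rewrite /dotp big_split_ord /= big_ord1 row_mxEr mxE eqxx mulr1n.
rewrite [in RHS]mxE; congr (_ + _ * _); rewrite [RHS]big_mkcond /=.
apply: eq_bigr => i _; rewrite row_mxEl !mxE.
by case: ifP => _; rewrite ?mulr1 ?mulr0.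
Qed.

Section Face.
Variables (w : 'rV[R]_(n + 1)) (c : R).
Hypothesis w_ge : forall z, lifted_polytope p z -> c <= dotp w z.

(** Lift [a] to a convex combination of lifted vertices in the face. Those with nonzero weight lie
    in the face, so they project to [a + s *: (b - a)] with [s >= 0]. These [s] average to zero,
    hence all vanish, and any such vertex lies over [a]. *)
Lemma face_vertex a b
    (F := (lifted_polytope p `&` [set z | dotp w z = c])%classic) :
  a != b -> ((fun z : 'rV_(n + 1) => lsubmx z) @` F)%classic = segment a b ->
  exists S, [/\ p S != +oo%E, a = indicator R S & dotp w (lifted S) = c].
Proof.
move=> ab Fab.
have [k ak] : exists k, a 0 k != b 0 k.
  apply/existsP; rewrite -negb_forall; apply: contra ab => /forallP ab.
  by apply/eqP/rowP => k; apply/eqP.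
have [z [[l [t [y [t0 t1 Xy zE]]]] wz] za] :
    ((fun z : 'rV_(n + 1) => lsubmx z) @` F)%classic a.
  by rewrite Fab; apply: subset_convex_hull; left.
have y_ge i : c <= dotp w (y i) by apply/w_ge/subset_convex_hull.
have y_min i : t i != 0 -> dotp w (y i) = c.
  move=> ti; have sum0 : \sum_i t i * (dotp w (y i) - c) = 0.
    under eq_bigr do rewrite mulrBr.
    by rewrite sumrB -mulr_suml t1 mul1r -dotp_sum -zE wz subrr.
  have ge0 i0 : true -> 0 <= t i0 * (dotp w (y i0) - c).
    by move=> _; rewrite mulr_ge0 // subr_ge0.
  have /eqP : t i * (dotp w (y i) - c) = 0 by apply: (psumr_eq0P ge0 sum0).
  by rewrite mulf_eq0 (negbTE ti) subr_eq0 => /eqP.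
have y_seg i : t i != 0 -> exists s, [/\ 0 <= s, s <= 1 &
    lsubmx (y i) = a + s *: (b - a)].
  move=> ti; apply: segmentP; rewrite -Fab; exists (y i) => //.
  by split; [exact: subset_convex_hull|exact: y_min].
have nz_ba : b 0 k - a 0 k != 0 by rewrite subr_eq0 eq_sym.
(* The position along the segment, read off at a coordinate where [a] and [b] differ. *)
pose s i := (lsubmx (y i) 0 k - a 0 k) / (b 0 k - a 0 k).
have sE i r : lsubmx (y i) = a + r *: (b - a) -> s i = r.
  by rewrite /s => ->; rewrite !mxE addrAC subrr add0r mulfK.
have ts_ge0 i : true -> 0 <= t i * s i.
  move=> _; have [->|ti] := eqVneq (t i) 0; first by rewrite mul0r.
  by have [r [r0 _ /sE ->]] := y_seg i ti; rewrite mulr_ge0.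
have sum_ts : \sum_i t i * s i = 0.
  under eq_bigr do rewrite /s mulrA mulrBr.
  rewrite -mulr_suml sumrB -[X in _ - X]mulr_suml t1 mul1r.
  have -> : \sum_i t i * lsubmx (y i) 0 k = a 0 k.
    rewrite -za zE linear_sum summxE; apply: eq_bigr => i _.
    by rewrite linearZ !mxE.
  by rewrite subrr mul0r.
have [i ti] : exists i, t i != 0.
  apply/existsP; rewrite -negb_forall; apply/negP => /forallP t_eq0.
  move: t1; rewrite big1 => [/eqP|i _]; last exact/eqP.
  by rewrite eq_sym oner_eq0.
have [r [_ _ yE]] := y_seg i ti.
have /eqP : t i * s i = 0 by apply: (psumr_eq0P ts_ge0 sum_ts).
rewrite (sE _ _ yE) mulf_eq0 (negbTE ti) /= => /eqP r0.
have [S Sdom SE] := Xy i; exists S; split=> //.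
  by rewrite -[RHS](row_mxKl _ (fine (p S))%:M) SE yE r0 scale0r addr0.
by rewrite /lifted SE y_min.
Qed.

End Face.

(** Dividing the supporting functional by its positive last coordinate yields [om] and the bound on
    [p]. Equality at [U] puts its indicator on the segment, where only the endpoints are 0/1
    points. *)
Lemma edge_minimizers a b : a != b -> induced_subdivision p (segment a b) ->
  exists S T (om : 'I_n -> R) (c : R),
    [/\ a = indicator R S, b = indicator R T,
        p S = (c - \sum_(i in S) om i)%:E, p T = (c - \sum_(i in T) om i)%:E
      & forall U, U != S -> U != T -> ((c - \sum_(i in U) om i)%:E < p U)%E].
Proof.
move=> ab [F [w [c [w0 w_ge FE _]]] Fab]; subst F.
have [S [Sdom aS Sc]] := face_vertex w_ge ab Fab.
have ba : b != a by rewrite eq_sym.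
rewrite segmentC in Fab; have [T [Tdom bT Tc]] := face_vertex w_ge ba Fab.
rewrite segmentC in Fab.
set d := rsubmx w 0 0 in w0.
have d0 : d != 0 by rewrite gt_eqF.
have sum_d U :
    \sum_(i in U) lsubmx w 0 i / d = (\sum_(i in U) lsubmx w 0 i) / d.
  by rewrite mulr_suml.
have fin_p U : p U != +oo%E -> p U = (fine (p U))%:E.
  by have := p_neqNy U; case: (p U).
exists S, T, (fun i => lsubmx w 0 i / d), (c / d); split=> //.
- rewrite fin_p // sum_d -mulrBl -Sc dotp_lift -/d addrAC subrr add0r.
  by rewrite mulrAC divff // mul1r.
- rewrite fin_p // sum_d -mulrBl -Tc dotp_lift -/d addrAC subrr add0r.
  by rewrite mulrAC divff // mul1r.
move=> U US UT; have [->|Udom] := eqVneq (p U) +oo%E; first by rewrite ltry.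
have liftedU : lifted_polytope p (lifted U).
  by apply: subset_convex_hull; exists U.
rewrite fin_p // lte_fin sum_d -mulrBl ltr_pdivrMr // mulrC ltrBlDl.
rewrite -dotp_lift lt_neqAle w_ge // andbT; apply/negP => /eqP Uc.
have : segment a b (indicator R U).
  rewrite -Fab; exists (lifted U); last exact: row_mxKl.
  by split.
move/segmentP => [s [_ _ Us]].
have [k kST] : exists k, (k \in S) != (k \in T).
  apply/existsP; rewrite -negb_forall; apply: contra ab => /forallP ST.
  by rewrite aS bT; apply/eqP; congr indicator; apply/setP => k; apply/eqP.
(* At a coordinate where [S] and [T] differ, the entry of [U] is [s] or [1 - s]. *)
have s01 : s = 0 \/ s = 1.
  have := congr1 (fun x : 'rV_n => x 0 k) Us; rewrite aS bT !mxE.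
  move: kST; case: (k \in S); case: (k \in T); case: (k \in U) => //= _ E;
  by [left; lra|right; lra].
case: s01 Us => ->; rewrite ?scale0r ?scale1r ?addr0 ?[a + _]addrC ?subrK.
  by rewrite aS => /indicator_inj E; rewrite E eqxx in US.
by rewrite bT => /indicator_inj E; rewrite E eqxx in UT.
Qed.

End Edges.

(** * Squarefree expansion *)

Section Multiaffine.
Variables (K : fieldType) (n : nat).

(** The exponent used in [compl_coef], so that [compl_coef f S] is [mcoeff (compl_mnm S) f] by
    conversion. *)
Definition compl_mnm (S : {set 'I_n}) : multinom n :=
  Multinom [tuple (i \notin S : nat) | i < n].

Lemma compl_mnmE S i : compl_mnm S i = (i \notin S).
Proof. by rewrite multinomE tnth_mktuple. Qed.

Lemma compl_mnm_inj : injective compl_mnm.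
Proof.
move=> S T ST; apply/setP => i; have := congr1 (fun U : multinom n => U i) ST.
by rewrite !compl_mnmE; case: (i \in S); case: (i \in T).
Qed.

Lemma compl_mnm_supp (U : multinom n) :
  (forall i, U i <= 1)%N -> U = compl_mnm [set i | U i == 0%N].
Proof.
move=> U1; apply/mnmP => i; rewrite compl_mnmE inE.
by have := U1 i; case: (U i) => [|[]].
Qed.

Lemma squarefree_monomialE (S : {set 'I_n}) :
  squarefree_monomial K (~: S) = mpolyX K (compl_mnm S).
Proof.
rewrite /squarefree_monomial mpolyXE_id big_mkcond; apply: eq_bigr => i _.
by rewrite compl_mnmE inE; case: (i \in S).
Qed.

Lemma multiaffine_expansion (f : mpoly n K) :
  (forall U i, U \in msupp f -> (U i <= 1)%N) ->
  f = \sum_(S : {set 'I_n}) compl_coef f S *: squarefree_monomial K (~: S).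
Proof.
move=> f1; apply/mpolyP => U; rewrite raddf_sum /=.
under eq_bigr do rewrite squarefree_monomialE mcoeffZ mcoeffX.
have [Uf|Uf] := boolP (U \in msupp f); last first.
  move: (Uf); rewrite -mcoeff_eq0 => /eqP f0; rewrite f0 big1 // => S _.
  have [E|_] := eqVneq (compl_mnm S) U; last by rewrite mulr0.
  by rewrite /compl_coef -/(compl_mnm S) E f0 mul0r.
have UE := compl_mnm_supp (fun i => f1 U i Uf).
rewrite (bigD1 [set i | U i == 0%N]) //= big1 => [|S neS].
  by rewrite addr0 /compl_coef -/(compl_mnm _) -UE eqxx mulr1.
rewrite [X in _ == X]UE; case: eqVneq => [/compl_mnm_inj E|].
  by rewrite E eqxx in neS.
by rewrite mulr0.
Qed.

End Multiaffine.

(** The monomial of [S] is supported on the complement, so the weights change sign and a constant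
    independent of [S] appears. *)
Lemma weight_compl_mnm (R : realType) n (om : 'I_n -> R) (S : {set 'I_n}) :
  weight (fun i => - om i) (compl_mnm S) = \sum_(i in S) om i - \sum_i om i.
Proof.
rewrite [in RHS]big_mkcond -sumrB; apply: eq_bigr => i _.
by rewrite compl_mnmE; case: (i \in S); rewrite /= ?mulr0 ?mulr1 ?subrr ?sub0r.
Qed.

Unset Implicit Arguments.

Theorem theorem6p2 (R : realType) (K : fieldType) (nu : K -> \bar R)
    (bar : {rmorphism K -> K}) (r n : nat) (A : 'M[K]_r)
    (v : 'I_n -> 'cV[K]_r) :
  nonarchimedean_valuation nu ->
  involutive bar ->
  (forall a, nu (bar a) = nu a) ->
  map_mx bar A = A^T \/ map_mx bar A = - A^T ->
  let f := det_poly bar A v in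
  let c := compl_coef f in
  f = \sum_(S : {set 'I_n}) c S *: squarefree_monomial K (~: S) /\
  valuated_delta_matroid (fun S => nu (c S)).
Proof.
move=> nuP barK nu_bar hermA f c.
have f_affine U i : U \in msupp f -> (U i <= 1)%N.
  by rewrite /f det_polyE; apply: det_pencil_multiaffine.
split; first exact: multiaffine_expansion.
split=> [S|a b ab edge]; first exact: valuation_neqNy.
(* A single sign [e] covers the Hermitian and skew-Hermitian cases. *)
have [e e2 barA] : exists2 e : K, e * e = 1 & map_mx bar A = e *: A^T.
  case: hermA => ->; first by exists 1; rewrite ?mulr1 ?scale1r.
  by exists (-1); rewrite ?mulrNN ?mulr1 ?scaleN1r.
have [|S [T [om [m [aS bT pS pT pU]]]]] := edge_minimizers _ ab edge.
  by move=> S; apply: valuation_neqNy.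
(* The shift absorbs the constant from [weight_compl_mnm]. *)
pose m' := m - \sum_i om i.
have wE U :
    m' - weight (fun i => - om i) (compl_mnm U) = m - \sum_(i in U) om i.
  by rewrite weight_compl_mnm /m'; ring.
have min_f L : L != compl_mnm S -> L != compl_mnm T ->
    ((m' - weight (fun i => - om i) L)%:E < nu (mcoeff L f))%E.
  have [Lf|] := boolP (L \in msupp f); last first.
    by rewrite -mcoeff_eq0 => /eqP ->; rewrite (nu0 nuP) ltry.
  rewrite (compl_mnm_supp (fun i => f_affine L i Lf)) wE => LS LT.
  by apply: pU; [apply: contra LS|apply: contra LT] => /eqP ->.
have pS' : nu (mcoeff (compl_mnm S) f) =
    (m' - weight (fun i => - om i) (compl_mnm S))%:E by rewrite wE.
have pT' : nu (mcoeff (compl_mnm T) f) =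
    (m' - weight (fun i => - om i) (compl_mnm T))%:E by rewrite wE.
have diff i : a 0 i != b 0 i -> (compl_mnm S i + compl_mnm T i = 1)%N.
  rewrite aS bT !mxE !compl_mnmE.
  by case: (i \in S); case: (i \in T); rewrite ?eqxx.
(* With a third differing coordinate [k], the exponent of [x_k] in the product of the two monomials
   would be 1, yet it is even in [x_i x_j] times a square. *)
rewrite leqNgt; apply/negP => /card_gt2P [i [j [k [[ai aj ak] [ij jk ki]]]]].
rewrite !inE in ai aj ak.
have [L] := det_poly_minimizers nuP barK nu_bar e2 barA ij (diff i ai)
  (diff j aj) pS' pT' min_f.
move/(congr1 (fun U : multinom n => U k)); rewrite !mnmDE diff // !mnm1E.
by rewrite (negbTE jk) [i == k]eq_sym (negbTE ki); lia.
Qed.
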